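(* For every integer $n\ge 2$, \[p(2,n)=\frac12\sum_{r=1}^{n-1}\left(\mathrm{dep}\left(\frac rn\right)-1\right)\sigma_0(\gcd(r,n)),\] where $\sigma_0(d)$ denotes the number of positive divisors of $d$.
   Context: $p(2,n)$ is the number of partitions of $n$ into exactly two distinct part sizes, i.e. the number of quadruples of integers $(n_1,n_2,k_1,k_2)$ with $n_1>n_2\ge1$, $k_1,k_2\ge1$ and $k_1n_1+k_2n_2=n$. The Farey map is $F(x)=(1-x)/x$ on $[1/2,1]$ and $F(x)=x/(1-x)$ on $[0,1/2]$. For a rational $x\in(0,1)$ in lowest terms, $\mathrm{dep}(x)=\ell+1$ where $\ell\ge0$ is least with $F^{\ell}(x)=1/2$ (equivalently, the level of $x$ in the Farey tree, with $\mathrm{dep}(1/2)=1$); for a fraction not in lowest terms, the depth is that of its reduced form. *)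

(* Defs.v *)
From mathcomp Require Import all_boot all_order all_algebra.
From mathcomp Require Import zify.

Set Implicit Arguments.
Unset Strict Implicit.
Unset Printing Implicit Defensive.

Import Order.TTheory GRing.Theory Num.Theory.

(* Quadruples (n1, n2, k1, k2), encoded as (((n1, n2), k1), k2). Every entry of
   a quadruple to be counted is at most n (see [partition2_bounded]), so the
   range {0, .., n} loses none. *)
Definition partition2 (n n1 n2 k1 k2 : nat) : bool :=
  [&& n2 < n1, 1 <= n2, 1 <= k1, 1 <= k2 & k1 * n1 + k2 * n2 == n].

Definition p2 (n : nat) : nat :=
  #|[set q : 'I_n.+1 * 'I_n.+1 * 'I_n.+1 * 'I_n.+1 |
      let: (n1, n2, k1, k2) := q in partition2 n n1 n2 k1 k2]|.

Lemma partition2_bounded (n n1 n2 k1 k2 : nat) :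
  partition2 n n1 n2 k1 k2 ->
  [&& n1 < n.+1, n2 < n.+1, k1 < n.+1 & k2 < n.+1].
Proof.
case/and5P=> n21 n2_gt0 k1_gt0 k2_gt0 /eqP <-.
by apply/and4P; split; nia.
Qed.

Definition sigma0 (d : nat) : nat := size (divisors d).

Local Open Scope ring_scope.

(* Meaningful for 0 <= x <= 1 only; both branches give 1 at x = 1/2. *)
Definition farey (x : rat) : rat :=
  if x <= 1 / 2 then x / (1 - x) else (1 - x) / x.

Lemma farey_frac_half (a b : nat) : (0 < a)%N -> (a < b)%N ->
  exists l, iter l farey (a%:R / b%:R) == 1 / 2.
Proof.
elim/ltn_ind: b a => b IHb a a_gt0 a_lt_b.
have a0 : a%:R != 0 :> rat by rewrite pnatr_eq0 -lt0n.
have b_gt0 : 0 < b%:R :> rat by rewrite ltr0n; lia.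
have b0 : b%:R != 0 :> rat by rewrite gt_eqF.
have ba0 : (b - a)%:R != 0 :> rat by rewrite pnatr_eq0; lia.
have oneB : 1 - a%:R / b%:R = (b - a)%:R / b%:R :> rat.
  by rewrite natrB ?(ltnW a_lt_b)// mulrBl divff.
have le_half : (a%:R / b%:R <= 1 / 2 :> rat) = (a * 2 <= b)%N.
  by rewrite ler_pdivrMr// mulrAC mul1r ler_pdivlMr// -natrM ler_nat.
have [ab2 | ab2] := eqVneq (a * 2)%N b.
  exists 0%N; rewrite /= -ab2 natrM invfM mulrA divff// mul1r.
have [l lP] : exists l, iter l farey (farey (a%:R / b%:R)) == 1 / 2.
  rewrite /farey le_half oneB; case: ifP => ab.
    have -> : a%:R / b%:R / ((b - a)%:R / b%:R) = a%:R / (b - a)%:R :> rat.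
      by rewrite -mulf_div divff ?invr_eq0// mulr1.
    by apply: IHb; lia.
  have -> : (b - a)%:R / b%:R / (a%:R / b%:R) = (b - a)%:R / a%:R :> rat.
    by rewrite -mulf_div divff ?invr_eq0// mulr1.
  by apply: IHb; lia.
by exists l.+1; rewrite iterSr.
Qed.

Lemma farey_reaches_half (x : rat) : 0 < x < 1 ->
  exists l, iter l farey x == 1 / 2.
Proof.
case/andP=> x_gt0 x_lt1.
have d0 : 0 < (denq x)%:~R :> rat by rewrite ltr0z denq_gt0.
have nE : `|numq x|%N%:R = (numq x)%:~R :> rat.
  by rewrite natr_absz gtr0_norm// numq_gt0.
have dE : `|denq x|%N%:R = (denq x)%:~R :> rat.
  by rewrite natr_absz gtr0_norm// denq_gt0.
rewrite -(divq_num_den x) -nE -dE; apply: farey_frac_half.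
  by rewrite absz_gt0 gt_eqF// numq_gt0.
rewrite -(ltr_nat rat) nE dE.
by move: x_lt1; rewrite -{1}(divq_num_den x) ltr_pdivrMr// mul1r.
Qed.

(* dep x depends on x as an element of rat, hence only on its reduced form.
   The value 0 outside (0, 1) is a dummy. *)
Definition dep (x : rat) : nat :=
  if boolP (0 < x < 1) is AltTrue x01
  then (ex_minn (farey_reaches_half x01)).+1 else 0%N.

(* Main.v *)
(** Write [l x = dep x - 1] and let [Q] be the set of quadruples
    [(n1, n2, k1, k2)] of positive integers with [k1 * n1 + k2 * n2 = n].  One
    subtractive Euclidean step
    [(n1, n2, k1, k2) |-> (n1 - n2, n2, k1, k1 + k2)] is a bijection from
    [{n2 < n1}] onto [{k1 < k2}] inside [Q], and it lowers
    [f = l (n1 / (n1 + n2))] by one, because [F (1 - x) = F x].  Hence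
    [p2 n] is the sum of [f] over [{n2 < n1}] minus its sum over [{k1 < k2}].
    As [f] is invariant under exchanging the two indices and vanishes on
    [n1 = n2], twice this difference is the sum of [f] over [{k1 = k2}]; there
    [r = k1 * n1] satisfies [r / n = n1 / (n1 + n2)], and [k1] is an arbitrary
    common divisor of [r] and [n]. *)
Require Import Defs.
From mathcomp Require Import all_boot all_order all_algebra.
From mathcomp Require Import zify ring lra.

Set Implicit Arguments.
Unset Strict Implicit.

Import Order.TTheory GRing.Theory Num.Theory.

Local Open Scope ring_scope.

(** * The Farey map, the depth, and the effect of a Euclidean step *)

Lemma farey_itv (x : rat) : 0 < x < 1 -> x != 1 / 2 -> 0 < farey x < 1.
Proof.
move=> /andP[x0 x1] xh; rewrite /farey; case: ifP => [xle|/negbT].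
  have xlt : x < 1 / 2 by rewrite lt_neqAle xh.
  have x1' : 0 < 1 - x by lra.
  by rewrite divr_gt0// ltr_pdivrMr// mul1r; lra.
rewrite -ltNge => xlt.
have x1' : 0 < 1 - x by lra.
by rewrite divr_gt0// ltr_pdivrMr// mul1r; lra.
Qed.

(** The reflection at 1/2 exchanges the two branches of [farey]. *)
Lemma farey_sub1 (x : rat) : farey (1 - x) = farey x.
Proof.
rewrite /farey subKr; case: (ltgtP x (1 / 2)) => [xlt|xgt|->].
- by rewrite lt_geF//; lra.
- by rewrite ifT//; lra.
- by have -> : 1 - 1 / 2 = 1 / 2 :> rat by lra.
Qed.

(** Hides the proof-dependent match inside [dep]: a least hitting time determines the depth. *)
Lemma depE (x : rat) (l : nat) : 0 < x < 1 -> iter l farey x == 1 / 2 ->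
  (forall m, iter m farey x == 1 / 2 -> (l <= m)%N) -> dep x = l.+1.
Proof.
rewrite /dep => x01 hl lmin; destruct (boolP (0 < x < 1)) as [h|h].
  case: ex_minnP => m hm mmin; congr _.+1; apply/eqP.
  by rewrite eqn_leq lmin// mmin.
by rewrite x01 in h.
Qed.

Lemma dep_gt0 (x : rat) : 0 < x < 1 -> (0 < dep x)%N.
Proof.
rewrite /dep => x01; destruct (boolP (0 < x < 1)) as [h|h] => //.
by rewrite x01 in h.
Qed.

Lemma dep_half : dep (1 / 2) = 1%N.
Proof. by apply: depE. Qed.

Lemma dep_farey (x : rat) : 0 < x < 1 -> x != 1 / 2 ->
  dep x = (dep (farey x)).+1.
Proof.
move=> x01 xh; have y01 := farey_itv x01 xh.
case: (ex_minnP (farey_reaches_half y01)) => l hl lmin.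
rewrite (depE y01 hl lmin); apply: depE => //; first by rewrite iterSr.
(* Time 0 is excluded by [x != 1 / 2]; any later hit of [x] is a hit of [farey x] one step
   earlier. *)
case=> [|m]; first by rewrite /= (negbTE xh).
by rewrite iterSr => /lmin.
Qed.

Lemma dep_sub1 (x : rat) : 0 < x < 1 -> dep (1 - x) = dep x.
Proof.
move=> x01; have [->|xh] := eqVneq x (1 / 2); first by congr dep; lra.
have xh' : 1 - x != 1 / 2 by apply: contraNneq xh => ?; apply/eqP; lra.
rewrite (dep_farey x01 xh) dep_farey ?farey_sub1//.
by case/andP: x01 => ? ?; apply/andP; split; lra.
Qed.

(** This is [f] as a function of the two part sizes. For positive [a] and [b] the argument lies in
    (0, 1), where [dep] is positive, so [.-1] does not truncate. *)
Definition level (a b : nat) : nat := (dep (a%:R / (a + b)%:R)).-1.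

Lemma ratio_itv (a b : nat) : (0 < a)%N -> (a < b)%N ->
  0 < (a%:R / b%:R : rat) < 1.
Proof.
move=> a0 ab; have b0 : 0 < b%:R :> rat by rewrite ltr0n; lia.
have x0 : 0 < a%:R :> rat by rewrite ltr0n.
by rewrite (divr_gt0 x0 b0) ltr_pdivrMr// mul1r ltr_nat.
Qed.

Lemma levelC (a b : nat) : (0 < a)%N -> (0 < b)%N -> level a b = level b a.
Proof.
move=> a0 b0; rewrite /level -dep_sub1; last by apply: ratio_itv => //; lia.
congr (dep _).-1; rewrite (addnC b a) natrD; field.
by rewrite -natrD pnatr_eq0; lia.
Qed.

Lemma level_diag (a : nat) : (0 < a)%N -> level a a = 0%N.
Proof.
move=> a0; rewrite /level; suff -> : a%:R / (a + a)%:R = 1 / 2 :> rat.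
  by rewrite dep_half.
by rewrite addnn -muln2 natrM invfM mulrA divff// pnatr_eq0 -lt0n.
Qed.

Lemma level_sub (a b : nat) : (0 < b)%N -> (b < a)%N ->
  level a b = (level (a - b)%N b).+1.
Proof.
(* Exchanging the indices on both sides gives the argument [b / (b + a)], which is below 1/2, so
   that [farey] takes its branch [x / (1 - x)] and yields [b / a]. *)
move=> b0 ba; rewrite levelC; [|lia|lia].
rewrite (@levelC (a - b)%N); [|lia|lia].
rewrite /level (subnKC (ltnW ba)).
have a0 : 0 < a%:R :> rat by rewrite ltr0n; lia.
have s0 : 0 < (b + a)%:R :> rat by rewrite ltr0n; lia.
have lt : b%:R < a%:R :> rat by rewrite ltr_nat.
have half : (b%:R / (b + a)%:R : rat) < 1 / 2.
  by rewrite ltr_pdivrMr// natrD; lra.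
rewrite dep_farey ?lt_eqF//; last by apply: ratio_itv => //; lia.
rewrite /farey (ltW half).
have -> : b%:R / (b + a)%:R / (1 - b%:R / (b + a)%:R) = b%:R / a%:R :> rat.
  have -> : 1 - b%:R / (b + a)%:R = a%:R / (b + a)%:R :> rat.
    by rewrite -[X in X - _](divff (lt0r_neq0 s0)) -mulrBl natrD addrAC subrr
         add0r.
  by rewrite -mulf_div divff ?mulr1// invr_eq0 lt0r_neq0.
by rewrite /= prednK// dep_gt0// ratio_itv.
Qed.

(* Reindexing and splitting finite sums *)
Local Close Scope ring_scope.

(** The maps need to be mutually inverse only on [P] and [Q]: those below use [inord] and truncated
    subtraction, and misbehave elsewhere. *)
Lemma sum_bij_on (I J : finType) (P : pred I) (Q : pred J) (h : I -> J)
    (h' : J -> I) (F : I -> nat) (G : J -> nat) :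
  (forall i, P i -> [/\ Q (h i), h' (h i) = i & F i = G (h i)]) ->
  (forall j, Q j -> P (h' j) /\ h (h' j) = j) ->
  \sum_(i | P i) F i = \sum_(j | Q j) G j.
Proof.
move=> hP hQ; rewrite (reindex_onto h' h) => [|i /hP[]//].
apply: eq_big => [j|j /andP[/hP[_ _ ->] /eqP->]//].
apply/andP/idP => [[/hP[hj _ _] /eqP<-]//|/hQ[-> ->]//].
Qed.

Lemma sum_trichotomy (I : finType) (P : pred I) (u v : I -> nat)
    (F : I -> nat) :
  \sum_(i | P i) F i =
    \sum_(i | P i && (u i < v i)) F i + \sum_(i | P i && (v i < u i)) F i
    + \sum_(i | P i && (u i == v i)) F i.
Proof.
rewrite (bigID (fun i => u i < v i)) -addnA; congr (_ + _).
rewrite (bigID (fun i => v i < u i)); congr (_ + _).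
  by apply: eq_bigl => i; rewrite -andbA; congr (_ && _); lia.
by apply: eq_bigl => i; rewrite -andbA; congr (_ && _); lia.
Qed.

(** * Solution quadruples and their symmetries *)

Section Quadruples.
Variable n : nat.

Definition quad : finType := ('I_n.+1 * 'I_n.+1 * 'I_n.+1 * 'I_n.+1)%type.
Implicit Types q : quad.

Definition part1 q : nat := q.1.1.1.
Definition part2 q : nat := q.1.1.2.
Definition mult1 q : nat := q.1.2.
Definition mult2 q : nat := q.2.

(** [inord] sends entries above [n] to 0, hence the bounds in [mkquadP]. *)
Definition mkquad (n1 n2 k1 k2 : nat) : quad :=
  (inord n1, inord n2, inord k1, inord k2).

Definition solution q : bool :=
  [&& 0 < part1 q, 0 < part2 q, 0 < mult1 q, 0 < mult2 q
    & mult1 q * part1 q + mult2 q * part2 q == n].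

Lemma mkquad_eta q : mkquad (part1 q) (part2 q) (mult1 q) (mult2 q) = q.
Proof. by case: q => [[[? ?] ?] ?]; rewrite /mkquad /= !inord_val. Qed.

Lemma mkquadP (n1 n2 k1 k2 : nat) :
  n1 <= n -> n2 <= n -> k1 <= n -> k2 <= n ->
  [/\ part1 (mkquad n1 n2 k1 k2) = n1, part2 (mkquad n1 n2 k1 k2) = n2,
      mult1 (mkquad n1 n2 k1 k2) = k1 & mult2 (mkquad n1 n2 k1 k2) = k2].
Proof. by move=> *; split; rewrite /part1 /part2 /mult1 /mult2 /= inordK. Qed.

Lemma solutionP q : solution q ->
  [/\ 0 < part1 q, 0 < part2 q, 0 < mult1 q, 0 < mult2 q
    & mult1 q * part1 q + mult2 q * part2 q = n].
Proof. by case/and5P=> ? ? ? ? /eqP. Qed.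

Definition swap q : quad := mkquad (part2 q) (part1 q) (mult2 q) (mult1 q).

(** For [n2 < n1] the weight is kept, as k1 * n1 + k2 * n2 = k1 * (n1 - n2) + (k1 + k2) * n2. *)
Definition step q : quad :=
  mkquad (part1 q - part2 q) (part2 q) (mult1 q) (mult1 q + mult2 q).

Definition step_inv q : quad :=
  mkquad (part1 q + part2 q) (part2 q) (mult1 q) (mult2 q - mult1 q).

Lemma part1_le q : part1 q <= n. Proof. exact: leq_ord. Qed.
Lemma part2_le q : part2 q <= n. Proof. exact: leq_ord. Qed.
Lemma mult1_le q : mult1 q <= n. Proof. exact: leq_ord. Qed.
Lemma mult2_le q : mult2 q <= n. Proof. exact: leq_ord. Qed.
#[local] Hint Resolve part1_le part2_le mult1_le mult2_le : core.

Lemma swapP q :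
  [/\ part1 (swap q) = part2 q, part2 (swap q) = part1 q,
      mult1 (swap q) = mult2 q & mult2 (swap q) = mult1 q].
Proof. exact: mkquadP. Qed.

Lemma swapK : involutive swap.
Proof.
move=> q; rewrite {1}/swap; case: (swapP q) => -> -> -> ->.
exact: mkquad_eta.
Qed.

Lemma solution_swap q : solution (swap q) = solution q.
Proof.
rewrite /solution; case: (swapP q) => -> -> -> ->.
by rewrite addnC; do 4![case: (0 < _); rewrite ?andbT ?andbF//].
Qed.

Definition quad_level q := level (part1 q) (part2 q).

Lemma sum_swap (R : pred quad) :
  \sum_(q | solution q && R q) quad_level q
  = \sum_(q | solution q && R (swap q)) quad_level q.
Proof.
apply: (@sum_bij_on _ _ _ _ swap swap) => q /andP[sq Rq].
  split; [by rewrite solution_swap sq swapK | exact: swapK |].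
  case: (swapP q) => e1 e2 _ _; rewrite /quad_level e1 e2 levelC//;
  by case/solutionP: sq.
by rewrite solution_swap sq Rq swapK.
Qed.

(** [swap] preserves solutions and levels and exchanges [u < v] with [v < u]. Applied to the parts
    as well as to the multiplicities. *)
Lemma sum_trichotomy_sym (u v : quad -> nat) :
  (forall q, u (swap q) = v q) -> (forall q, v (swap q) = u q) ->
  \sum_(q | solution q) quad_level q =
    (\sum_(q | solution q && (u q < v q)) quad_level q).*2
    + \sum_(q | solution q && (u q == v q)) quad_level q.
Proof.
move=> uE vE; rewrite (sum_trichotomy _ u v) -addnn; congr (_ + _ + _).
rewrite (sum_swap (fun q => v q < u q)).
by apply: eq_bigl => q; rewrite uE vE.
Qed.

Lemma sum_step :
  \sum_(q | solution q && (part2 q < part1 q)) (quad_level q).-1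
  = \sum_(q | solution q && (mult1 q < mult2 q)) quad_level q.
Proof.
apply: (@sum_bij_on _ _ _ _ step step_inv) => q /andP[sq lt];
  case/solutionP: (sq) => n1_gt0 n2_gt0 k1_gt0 k2_gt0 nE.
  have [e1 e2 e3 e4] : [/\ part1 (step q) = part1 q - part2 q,
      part2 (step q) = part2 q, mult1 (step q) = mult1 q
      & mult2 (step q) = mult1 q + mult2 q].
    by apply: mkquadP => //; nia.
  split.
  - rewrite /solution e1 e2 e3 e4.
    by apply/andP; split; [apply/and5P; split => //; nia | lia].
  - by rewrite /step_inv e1 e2 e3 e4 (subnK (ltnW lt)) addKn mkquad_eta.
  - by rewrite /quad_level e1 e2 level_sub.
have [e1 e2 e3 e4] : [/\ part1 (step_inv q) = part1 q + part2 q,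
    part2 (step_inv q) = part2 q, mult1 (step_inv q) = mult1 q
    & mult2 (step_inv q) = mult2 q - mult1 q].
  by apply: mkquadP => //; nia.
split.
  rewrite /solution e1 e2 e3 e4.
  by apply/andP; split; [apply/and5P; split => //; nia | lia].
by rewrite /step e1 e2 e3 e4 addnK (subnKC (ltnW lt)) mkquad_eta.
Qed.

(** * Evaluating the total level in two ways *)

Lemma p2E : p2 n = \sum_(q | solution q && (part2 q < part1 q)) 1.
Proof.
rewrite /p2 -sum1_card; apply: eq_bigl => -[[[n1 n2] k1] k2].
rewrite inE /partition2 /solution /part1 /part2 /mult1 /mult2 /=.
by lia.
Qed.

Lemma double_p2 :
  (p2 n).*2 = \sum_(q | solution q && (mult1 q == mult2 q)) quad_level q.
Proof.
have split_parts : \sum_(q | solution q && (part2 q < part1 q)) quad_level q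
    = p2 n + \sum_(q | solution q && (mult1 q < mult2 q)) quad_level q.
  (* Each level on the left is positive by [level_sub], hence 1 plus its predecessor; the ones add
     up to [p2 n]. *)
  rewrite p2E -sum_step -big_split; apply: eq_bigr => q /andP[sq lt].
  by case/solutionP: sq => *; rewrite /quad_level level_sub.
have diag0 : \sum_(q | solution q && (part2 q == part1 q)) quad_level q = 0.
  apply: big1 => q /andP[/solutionP[? ? _ _ _] /eqP e].
  by rewrite /quad_level e level_diag.
have : \sum_(q | solution q) quad_level q
    = (p2 n + \sum_(q | solution q && (mult1 q < mult2 q)) quad_level q).*2.
  rewrite (@sum_trichotomy_sym part2 part1); last 2 first.
  - by move=> q; case: (swapP q).
  - by move=> q; case: (swapP q).
  by rewrite diag0 addn0 split_parts.
rewrite (@sum_trichotomy_sym mult1 mult2); last 2 first.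
- by move=> q; case: (swapP q).
- by move=> q; case: (swapP q).
(* Both expressions for the total contain twice the sum over [mult1 q < mult2 q], which cancels. *)
by rewrite doubleD addnC => /addIn.
Qed.

Lemma sum_equal_mult :
  \sum_(q | solution q && (mult1 q == mult2 q)) quad_level q
  = \sum_(1 <= r < n) (dep (r%:R / n%:R)%R).-1 * sigma0 (gcdn r n).
Proof.
pose P (i : 'I_n.+1 * 'I_n.+1) :=
  (0 < i.1 < n) && (i.2 %| gcdn i.1 n).
transitivity (\sum_(i | P i) (dep (i.1%:R / n%:R)%R).-1).
  (* With common multiplicity [d] the equation is d * (n1 + n2) = n, so [r = d * n1] and [d] recover
     the parts as [r / d] and [(n - r) / d]. *)
  apply: (@sum_bij_on _ _ _ _
    (fun q => (inord (mult1 q * part1 q), inord (mult1 q)))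
    (fun i => mkquad (i.1 %/ i.2) ((n - i.1) %/ i.2) i.2 i.2)) => [q|[r d]].
    case/andP=> /solutionP[n1_gt0 n2_gt0 k1_gt0 _ +] /eqP e.
    rewrite -e => nE.
    have rE : (inord (mult1 q * part1 q) : 'I_n.+1) = mult1 q * part1 q :> nat.
      by rewrite inordK//; nia.
    have dE : (inord (mult1 q) : 'I_n.+1) = mult1 q :> nat
      by rewrite inordK// ltnS.
    split.
    - have kn : mult1 q %| n by rewrite -[X in _ %| X]nE -mulnDr dvdn_mulr.
      by rewrite /P /= rE dE dvdn_gcd dvdn_mulr// kn !andbT; nia.
    - rewrite /= rE dE mulKn//.
      have -> : (n - mult1 q * part1 q) %/ mult1 q = part2 q.
        by rewrite -{1}nE addKn mulKn.
      by rewrite {2}e mkquad_eta.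
    - rewrite /= rE /quad_level /level; congr (dep _).-1.
      rewrite -nE -mulnDr !natrM -mulf_div divff ?mul1r//.
      by rewrite pnatr_eq0 -lt0n.
  case/andP => /= /andP[r_gt0 r_lt]; rewrite dvdn_gcd => /andP[dr dn].
  have d_gt0 : 0 < d by apply: dvdn_gt0 dr.
  have dnr : d %| n - r by rewrite dvdn_sub.
  have [] := @mkquadP (r %/ d) ((n - r) %/ d) d d.
  - by rewrite (leq_trans (leq_div _ _))// ltnW.
  - by rewrite (leq_trans (leq_div _ _))// leq_subr.
  - exact: leq_ord.
  - exact: leq_ord.
  set q := mkquad _ _ _ _ => e1 e2 e3 e4.
  split.
    rewrite /solution e1 e2 e3 e4 eqxx !divn_gt0// !d_gt0 !(mulnC d) !divnK//.
    rewrite (dvdn_leq r_gt0 dr) (dvdn_leq _ dnr) ?subn_gt0//.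
    by rewrite subnKC ?eqxx// ltnW.
  by rewrite e1 e3 mulnC divnK// !inord_val.
rewrite -(pair_big_dep (fun r : 'I_n.+1 => 0 < r < n)
  (fun (r d : 'I_n.+1) => d %| gcdn r n)
  (fun (r _ : 'I_n.+1) => (dep (r%:R / n%:R)%R).-1)) /=.
rewrite (big_nat_widen 1 n n.+1)// (big_nat_widenl 1 0)// big_mkord.
apply: eq_big => [r|r /andP[r_gt0 r_lt]]; first by rewrite andbC.
(* The summand is independent of [d], so what remains is to count the [d] in ['I_n.+1] dividing the
   gcd. *)
rewrite sum_nat_const mulnC; congr (_ * _).
have g_gt0 : 0 < gcdn r n by rewrite gcdn_gt0 r_gt0.
rewrite /sigma0 cardE -(size_map val); apply/perm_size/uniq_perm.
- by rewrite map_inj_uniq ?enum_uniq//; exact: val_inj.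
- exact: divisors_uniq.
move=> d; rewrite -dvdn_divisors//; apply/mapP/idP => [[e + ->]|dg].
  by rewrite mem_enum.
have d_lt : d < n.+1.
  by rewrite ltnS (leq_trans (dvdn_leq _ dg))// dvdn_leq ?dvdn_gcdr; lia.
by exists (Ordinal d_lt) => //; rewrite mem_enum.
Qed.

End Quadruples.

Unset Implicit Arguments.
Set Strict Implicit.

Local Open Scope ring_scope.

Theorem theorem4p20 (n : nat) (hn : (2 <= n)%N) :
  (p2 n)%:R =
    1 / 2 * \sum_(1 <= r < n)
      ((dep (r%:R / n%:R))%:R - 1) * (sigma0 (gcdn r n))%:R :> rat.
Proof.
suff -> : \sum_(1 <= r < n)
    ((dep (r%:R / n%:R))%:R - 1) * (sigma0 (gcdn r n))%:R
    = ((p2 n).*2)%:R :> rat.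
  by rewrite -muln2 natrM; field.
rewrite double_p2 sum_equal_mult natr_sum; apply: eq_big_nat => r /andP[r0 rn].
(* Positivity of [dep] on (0, 1) turns the natural predecessor into a rational subtraction. *)
by rewrite natrM -subn1 natrB// dep_gt0// ratio_itv.
Qed.
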